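(* Let $0 < \varepsilon < 1/2$ and let $W\geq 1$ be an integer. Set $\lambda = \frac{\varepsilon}{100W}$. Let $\beta \geq \beta^- + 2$ (with $\beta\geq 3$) be integers such that $\frac{\beta}{\log(\beta)} \geq 2 W^2\lambda^{-2}$ and $\beta^- \geq (1 - \lambda) \cdot \beta$. Let $G$ be a simple graph with integer edge weights in $\{1,\dots,W\}$. Then any $(\beta, \beta^-)$-$w$-EDCS $H$ of $G$ contains a matching $M_H$ such that $\left(2 - \frac{1}{2W} + \varepsilon\right)\cdot w(M_H) \geq w(M_G)$, where $M_G$ is a maximum weight matching of $G$.
   Context: For a subgraph $H$ of $G$ and vertex $v$, $N_H(v)$ is the set of neighbours of $v$ in $H$ and $\mathbf{w}\!\deg_H(v)=\sum_{u\in N_H(v)}w(u,v)$, where $w(u,v)$ is the weight of edge $(u,v)$; $w(M)$ is the total weight of a matching $M$. For integers $\beta\geq 3$ and $\beta^-\leq\beta-2$, a subgraph $H$ of $G$ is a $(\beta,\beta^-)$-$w$-EDCS of $G$ if (i) for every edge $(u,v)\in H$, $\mathbf{w}\!\deg_H(u)+\mathbf{w}\!\deg_H(v)\leq\beta\cdot w(u,v)$, and (ii) for every edge $(u,v)\in G\setminus H$, $\mathbf{w}\!\deg_H(u)+\mathbf{w}\!\deg_H(v)\geq\beta^-\cdot w(u,v)$. *)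

(* Defs.v *)
From mathcomp Require Import all_boot all_order all_algebra.

Set Implicit Arguments.
Unset Strict Implicit.
Unset Printing Implicit Defensive.

Import Order.TTheory GRing.Theory Num.Theory.

(* A finite simple graph on the vertex type T is given by its edge set, whose
   elements are the unordered pairs [set u; v] with u != v.  A subgraph is given
   by a subset of the edge set: deleting isolated vertices changes neither
   degrees nor matchings.  The weight of the edge (u, v) is w [set u; v]; the
   values of w outside the edge set are irrelevant. *)

Section WeightedGraphs.

Variable T : finType.
Implicit Types (G H M : {set {set T}}) (w : {set T} -> nat).

Definition simple_graph G : Prop := forall e, e \in G -> #|e| = 2.

Definition neighbours H (v : T) : {set T} := [set u | [set u; v] \in H].

Definition wdeg w H (v : T) : nat := \sum_(u in neighbours H v) w [set u; v].

Definition matching H M : Prop := M \subset H /\ trivIset M.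

Definition weight w M : nat := \sum_(e in M) w e.

Definition max_weight_matching w G M : Prop :=
  matching G M /\ forall M', matching G M' -> weight w M' <= weight w M.

Definition wEDCS w (beta betam : int) G H : Prop :=
  [/\ H \subset G,
      forall u v, [set u; v] \in H ->
        ((wdeg w H u)%:Z + (wdeg w H v)%:Z <= beta * (w [set u; v])%:Z)%R
    & forall u v, [set u; v] \in G :\: H ->
        (betam * (w [set u; v])%:Z <= (wdeg w H u)%:Z + (wdeg w H v)%:Z)%R].

End WeightedGraphs.

(* Main.v *)
(* Choose a random cut of the vertices among those separating the two ends of
   every edge of M_G, and let H' be the bipartite graph of the edges of H that
   are cut.  Put D = wdeg_H / beta; a second moment computation shows that twice
   the normalised degree in H' deviates from D by at most lambda on average, so
   some cut makes the deviations, summed over the vertices of M_G and over their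
   H-neighbours, of order lambda * |M_G|.  This average control is enough, and
   replaces the usual appeal to the Lovasz local lemma.

   Let y be an optimal integral vertex cover of the weights on H' (Egervary), of
   total Y = w(M_H), with values in [0, W].  An edge e of M_G that y fails to
   cover lies outside H, so the sum of g = D - y over its two ends is at least
   its deficit, up to lambda * w(e); by integrality that deficit is at least 1.
   For u an end of such an edge with g(u) > 0 and z an H'-neighbour of u, put
   q = w(u,z) - y(u) <= y(z); property (i) of H says g(u) + D(z) <= q.  Adding
   these inequalities with multipliers q / y(z) bounds the total deficit by
   (1 - 1/(2W)) Y, up to an error of order lambda * w(M_G), and w(M_G) is at
   most Y plus the total deficit. *)

Require Import Defs.
From mathcomp Require Import all_boot all_order all_algebra.
From mathcomp Require Import reals exp.
From mathcomp Require Import ring lra.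

Set Implicit Arguments.
Unset Strict Implicit.
Unset Printing Implicit Defensive.

Import Order.TTheory GRing.Theory Num.Theory.

(** * Integral duality for bipartite weighted matching *)

Lemma trivIset_mem (T : finType) (P : {set {set T}}) (A B : {set T}) (x : T) :
  trivIset P -> A \in P -> B \in P -> x \in A -> x \in B -> A = B.
Proof.
move=> tI PA PB Ax Bx.
by rewrite -(def_pblock tI PA Ax) (def_pblock tI PB Bx).
Qed.

(** Let K be the set reached from [u] by alternating paths. Every edge of [M1 :|: M2] lies inside K
    or misses it, so exchanging the matchings inside K gives matchings of the same total weight.
    [M2'] follows [M1] inside K, where it misses [u], and [M2] outside, where it misses [v]. *)
Lemma swap_matchings (T : finType) (s : pred T) (M1 M2 : {set {set T}})
    (u v : T) :
    {in M1 :|: M2, forall e, exists x y, [/\ s x, ~~ s y & e = [set x; y]]} ->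
    trivIset M1 -> trivIset M2 -> s u -> ~~ s v ->
    u \notin cover M1 -> v \notin cover M2 ->
  exists M1' M2' : {set {set T}},
    [/\ M1' \subset M1 :|: M2, M2' \subset M1 :|: M2, trivIset M1' &
        trivIset M2'] /\
    [/\ u \notin cover M2', v \notin cover M2' &
        forall w : {set T} -> nat,
          weight w M1' + weight w M2' = weight w M1 + weight w M2].
Proof.
move=> bip tI1 tI2 su sv u1 v2.
(* Alternating paths from u are directed, so that no parity argument is needed:
   such a path can only enter v through M2, which misses v. *)
pose r := [rel x y | [set x; y] \in if s x then M2 else M1].
pose K := [set x | connect r u x].
have Ku : u \in K by rewrite inE connect0.
have Kstep x y : x \in K -> r x y -> y \in K.
  by rewrite !inE => Kx rxy; exact: connect_trans Kx (connect1 rxy).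
have Kpred x : x \in K -> x = u \/ exists2 y, y \in K & r y x.
  rewrite inE => /connectP[p]; elim/last_ind: p => [|p z _] /=; first by left.
  rewrite rcons_path last_rcons => /andP[pth rz] ->; right.
  by exists (last u p) => //; rewrite inE; apply/connectP; exists p.
have rside x y : r x y -> s y = ~~ s x.
  move=> rxy; have /bip[a [b [sa sb E]]] : [set x; y] \in M1 :|: M2.
    by move: rxy; rewrite /r /= in_setU; case: (s x) => ->; rewrite ?orbT.
  have : a \in [set x; y] by rewrite E set21.
  have : b \in [set x; y] by rewrite E set22.
  by case/set2P=> ?; case/set2P=> ?; subst;
    rewrite ?(negPf sb) ?sa //; rewrite sa in sb.
have Kv : v \notin K.
  apply/negP => /Kpred[vu|[y Ky ryv]]; first by rewrite vu su in sv.
  move: (rside _ _ ryv) (ryv) => /esym; rewrite /r /= (negPf sv) => /negbFE ->.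
  move=> e2; case/negP: v2; apply/bigcupP; exists [set y; v] => //.
  exact: set22.
(* A forward edge at [x] extends the path. A backward edge is the one by which [x] was entered,
   since a matching has one edge at [x]; at [u] there is none, as [M1] misses [u]. *)
have Kcl e x y : e \in M1 :|: M2 -> x \in e -> y \in e -> x \in K -> y \in K.
  have [->//|nxy] := eqVneq x y.
  move=> eM xe ye Kx; have eE : e = [set x; y].
    have [a [b [sa sb E]]] := bip _ eM; move: xe ye; rewrite E !inE.
    by move=> /orP[]/eqP ? /orP[]/eqP ?; subst; rewrite ?eqxx // in nxy *;
       rewrite setUC.
  have sxy : s y = ~~ s x.
    have [a [b [sa sb E]]] := bip _ eM; move: xe ye; rewrite E !inE.
    move=> /orP[]/eqP ? /orP[]/eqP ?; subst; rewrite ?eqxx // in nxy.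
      by rewrite sa (negPf sb).
    by rewrite sa (negPf sb).
  have [fw|nfw] := boolP (e \in if s x then M2 else M1).
    by apply: (Kstep x) => //; rewrite /r /= -eE.
  have bw : e \in if s x then M1 else M2.
    by move: eM nfw; rewrite inE; case: (s x) => /orP[]-> //.
  case: (Kpred x Kx) => [xu|[z Kz rzx]].
    case/negP: u1; apply/bigcupP; exists e; last by rewrite -xu.
    by rewrite xu su in bw.
  have sz := rside _ _ rzx.
  have zx : [set z; x] \in if s x then M1 else M2.
    by move: rzx; rewrite /r /= sz; case: (s z).
  have E : e = [set z; x].
    have xz : x \in [set z; x] by rewrite set22.
    case: ifP zx bw => _ zx bw; first exact: (trivIset_mem tI1 bw zx xe).
    exact: (trivIset_mem tI2 bw zx xe).
  have : z \in e by rewrite E set21.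
  rewrite eE => /set2P[] zE; first by move: sz; rewrite zE; case: (s x).
  by rewrite -zE.
have Kdis e : e \in M1 :|: M2 -> ~~ (e \subset K) -> [disjoint e & K].
  move=> eM; apply: contraR => /pred0Pn[x /andP[/= xe Kx]].
  by apply/subsetP => y ye; exact: Kcl eM xe ye Kx.
pose B := powerset K.
pose sw (X Y : {set {set T}}) := (X :\: B) :|: (Y :&: B).
have swt (X Y : {set {set T}}) :
    X \subset M1 :|: M2 -> trivIset X -> trivIset Y -> trivIset (sw X Y).
  move=> sX tX tY; apply/trivIsetP => C E.
  have sep C' E' : C' \in X :\: B -> E' \in Y :&: B -> [disjoint C' & E'].
    rewrite !inE => /andP[C'K C'X] /andP[_ E'K].
    apply: disjointWr E'K _; apply: Kdis => //.
    exact: subsetP sX _ C'X.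
  rewrite !(in_setU C) !(in_setU E) => /orP[hC|hC] /orP[hE|hE] CE.
  - move: hC hE; rewrite !inE => /andP[_ hC] /andP[_ hE].
    exact: (trivIsetP tX).
  - exact: sep.
  - by rewrite disjoint_sym; exact: sep.
  - move: hC hE; rewrite !inE => /andP[hC _] /andP[hE _].
    exact: (trivIsetP tY).
have sws (X Y : {set {set T}}) : sw X Y \subset X :|: Y.
  by apply: setUSS; [exact: subsetDl | exact: subsetIl].
exists (sw M1 M2), (sw M2 M1); split; split.
- exact: sws.
- by rewrite (setUC M1); exact: sws.
- by apply: swt => //; exact: subsetUl.
- by apply: swt => //; exact: subsetUr.
- apply: contra u1 => /bigcupP[e]; rewrite !inE => /orP[]/andP[h1 h2] ue.
    have /(Kdis e)/(_ h1)/disjoint_setI0 : e \in M1 :|: M2.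
      by rewrite inE h2 orbT.
    by move/setP/(_ u); rewrite in_setI ue Ku inE.
  by apply/bigcupP; exists e.
- apply: contra v2 => /bigcupP[e]; rewrite !inE => /orP[]/andP[h1 h2] ve.
    by apply/bigcupP; exists e.
  by have := subsetP h2 _ ve; rewrite (negPf Kv).
- move=> w; rewrite /weight.
  have swI (X Y : {set {set T}}) : sw X Y :&: B = Y :&: B.
    by apply/setP => e; rewrite !(in_setU, in_setI, in_setD);
      case: (e \in X) (e \in Y) (e \in B) => [] [] [].
  have swD (X Y : {set {set T}}) : sw X Y :\: B = X :\: B.
    by apply/setP => e; rewrite !(in_setU, in_setI, in_setD);
      case: (e \in X) (e \in Y) (e \in B) => [] [] [].
  have split_sum (X : {set {set T}}) : \sum_(e in X) w e
      = \sum_(e in X :&: B) w e + \sum_(e in X :\: B) w e.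
    exact: big_setID.
  rewrite (split_sum (sw M1 M2)) (split_sum (sw M2 M1)) !swI !swD.
  rewrite (split_sum M1) (split_sum M2) [RHS]addnACA addnACA.
  by rewrite (addnC (\sum_(e in M2 :&: B) _)).
Qed.

(** Induction on the total weight. Given a positive edge, lower by one the weights at one of its
    ends: if the maximum drops, a cover of the lowered weights plus one at that end works. If it
    drops for neither end, each end is missed by some maximum matching; swapping yields one missing
    both, and adding the edge beats the maximum. *)
Lemma egervary (T : finType) (s : pred T) (H : {set {set T}})
    (w : {set T} -> nat) :
    {in H, forall e, exists x y, [/\ s x, ~~ s y & e = [set x; y]]} ->
  exists (M : {set {set T}}) (y : T -> nat),
    [/\ matching H M, {in H, forall e, w e <= \sum_(x in e) y x} &
        \sum_x y x <= weight w M].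
Proof.
move=> bip.
have [n] := ubnP (\sum_(e in H) w e); elim: n w => // n IH w.
rewrite ltnS => len.
have [/existsP[e /andP[eH we]]|no] := boolP [exists e, (e \in H) && (0 < w e)];
  last first.
  exists set0, (fun=> 0); split.
  - by split; [exact: sub0set | apply/trivIsetP => A; rewrite inE].
  - move=> e eH; rewrite big1 // leqn0 -leqn0 leqNgt.
    by apply: contra no => we; apply/existsP; exists e; rewrite eH.
  - by rewrite big1.
pose mt (M : {set {set T}}) := (M \subset H) && trivIset M.
have mt0 : mt set0.
  by rewrite /mt sub0set; apply/trivIsetP => A; rewrite inE.
case: (@arg_maxnP _ set0 mt (weight w) mt0) => M0 /andP[M0H M0t] M0max.
(* Truncated subtraction: edges of weight zero keep weight zero. *)
pose red (a : T) (e : {set T}) := w e - (a \in e).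
have step a : a \in e ->
    ~~ [exists M, mt M && (weight w M0 <= weight (red a) M)] ->
  exists (M : {set {set T}}) (y : T -> nat),
    [/\ matching H M, {in H, forall e, w e <= \sum_(x in e) y x} &
        \sum_x y x <= weight w M].
  move=> ae noM.
  have [|M [y [[MH Mt] cov wM]]] := IH (red a).
    apply: leq_trans len; rewrite (bigD1 e) //= [X in _ < X](bigD1 e) //=.
    rewrite -addSn leq_add //; first by rewrite /red ae subn1 prednK.
    by apply: leq_sum => f _; rewrite /red leq_subr.
  exists M0, (fun x => y x + (x == a)); split => //.
  - move=> f fH; rewrite big_split /=.
    have -> : \sum_(x in f) (x == a) = (a \in f).
      rewrite big_mkcond (bigD1 a) //= eqxx big1 => [|x /negPf->].
        by case: (a \in f).
      by case: ifP.
    by rewrite addnC -leq_subLR; exact: cov.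
  - rewrite big_split /=.
    rewrite (bigD1 (P := predT) (F := fun x => nat_of_bool (x == a)) a) //= eqxx.
    rewrite [X in 1 + X]big1 => [|x /negPf->//].
    rewrite addn0 addn1; apply: leq_ltn_trans wM _.
    rewrite ltnNge; apply: contra noM => h; apply/existsP; exists M.
    by rewrite /mt MH Mt.
have [u [v [su sv eE]]] := bip e eH.
have [/existsP[M1 /andP[/andP[M1H M1t] w1]]|] :=
  boolP [exists M, mt M && (weight w M0 <= weight (red u) M)]; last first.
  by apply: step; rewrite eE set21.
have [/existsP[M2 /andP[/andP[M2H M2t] w2]]|] :=
  boolP [exists M, mt M && (weight w M0 <= weight (red v) M)]; last first.
  by apply: step; rewrite eE set22.
have drop a (M : {set {set T}}) : mt M -> weight w M0 <= weight (red a) M ->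
    let M' := [set f in M | a \notin f] in
    [/\ M' \subset H, trivIset M', a \notin cover M' &
        weight w M0 <= weight w M'].
  move=> /andP[MH Mt] wM M'.
  have sM' : M' \subset M by apply/subsetP => f; rewrite inE => /andP[].
  have tM' : trivIset M'.
    apply/trivIsetP => A B /(subsetP sM') hA /(subsetP sM') hB.
    exact: (trivIsetP Mt).
  split => //; first exact: subset_trans MH.
    by apply/negP => /bigcupP[f]; rewrite inE => /andP[_ /negPf->].
  have wM0 : weight w M <= weight w M0 by apply: M0max; rewrite /mt MH.
  (* M attains the maximum both for w and for red a, so its edge at a, if any,
     has weight zero. *)
  have := wM; rewrite /weight [X in _ <= X](big_setID M') /= (setIidPr sM').
  have -> : \sum_(i in M') red a i = \sum_(i in M') w i.
    by apply: eq_bigr => f; rewrite inE /red => /andP[_ /negPf->]; rewrite subn0.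
  suff -> : \sum_(i in M :\: M') red a i = 0 by rewrite addn0.
  have aD f : f \in M :\: M' -> a \in f.
    by rewrite !inE => /andP[]; rewrite negb_and negbK => /orP[/negP//|].
  apply/eqP; rewrite sum_nat_eq0; apply/forallP => f; apply/implyP => fD.
  rewrite /red (aD f fD) -leqn0 leqNgt; apply/negP => pos.
  have wf : 0 < w f := leq_trans pos (leq_subr _ _).
  have : weight (red a) M < weight w M.
    rewrite /weight (bigD1 f) /=; last by move: fD; rewrite inE => /andP[].
    rewrite [X in _ < X](bigD1 f) /=; last by move: fD; rewrite inE => /andP[].
    rewrite -addSn; apply: leq_add; first by rewrite /red (aD f fD) subn1 prednK.
    by apply: leq_sum => g _; rewrite /red leq_subr.
  by rewrite ltnNge (leq_trans wM0 wM).
have [|s1 t1 u1 w1'] := drop u M1 _ w1; first by rewrite /mt M1H.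
have [|s2 t2 v2 w2'] := drop v M2 _ w2; first by rewrite /mt M2H.
set M1' := [set f in M1 | _] in s1 t1 u1 w1'.
set M2' := [set f in M2 | _] in s2 t2 v2 w2'.
have sU : M1' :|: M2' \subset H by rewrite subUset s1.
have bipU : {in M1' :|: M2', forall e,
    exists x y, [/\ s x, ~~ s y & e = [set x; y]]}.
  by move=> f /(subsetP sU)/bip.
have [N1 [N2 [[N1s N2s N1t N2t] [uN vN wN]]]] :=
  swap_matchings bipU t1 t2 su sv u1 v2.
have N1max : weight w N1 <= weight w M0.
  by apply: M0max; rewrite /mt (subset_trans N1s).
have eN2 : e \notin N2.
  apply: contra uN => eN; apply/bigcupP; exists e => //.
  by rewrite eE set21.
have : weight w (e |: N2) <= weight w M0.
  apply: M0max; rewrite /mt subUset sub1set eH (subset_trans N2s) //=.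
  have dis f : f \in N2 -> [disjoint e & f].
    move=> fN; rewrite eE; apply/pred0P => x /=; rewrite !inE.
    apply/negP => /andP[/orP[]/eqP-> xf].
      by case/negP: uN; apply/bigcupP; exists f.
    by case/negP: vN; apply/bigcupP; exists f.
  apply/trivIsetP => A B; rewrite !in_setU1.
  move=> /orP[/eqP->|hA] /orP[/eqP->|hB].
  - by rewrite eqxx.
  - by move=> _; exact: dis.
  - by rewrite disjoint_sym => _; exact: dis.
  - exact: (trivIsetP N2t).
(* [N1] and [N2] together weigh at least twice the maximum and [N1] at most once, so [N2] attains
   it. *)
have N2max : weight w M0 <= weight w N2.
  rewrite -(leq_add2l (weight w M0)); apply: leq_trans (leq_add w1' w2') _.
  by rewrite -wN leq_add2r.
by rewrite [X in X <= _]/weight big_setU1 //= leqNgt -add1n leq_add.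
Qed.

Local Open Scope ring_scope.

(** * Random cuts separating the ends of a matching *)

Definition cut_by (T : finType) (s : {ffun T -> bool}) (e : {set T}) : bool :=
  [exists x in e, exists y in e, s x != s y].

(** Sample space of the random cut; means appear as sums over it, compared with multiples of its
    cardinality. *)
Definition cuts (T : finType) (M : {set {set T}}) : {set {ffun T -> bool}} :=
  [set s | [forall e in M, cut_by s e]].

Lemma cut_by2 (T : finType) (s : {ffun T -> bool}) (x y : T) :
  cut_by s [set x; y] = (s x != s y).
Proof.
apply/idP/idP => [/exists_inP[a ha /exists_inP[b hb]]|sxy].
  by case/set2P: ha => ->; case/set2P: hb => ->; rewrite ?eqxx // eq_sym.
by apply/exists_inP; exists x; rewrite ?set21 //; apply/exists_inP; exists y;
   rewrite ?set22.
Qed.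

Lemma cuts_neq0 (T : finType) (M : {set {set T}}) :
  simple_graph M -> trivIset M -> cuts M != set0.
Proof.
move=> M2 Mt; apply/set0Pn.
(* One vertex picked from each block goes to one side, all other vertices to the other. *)
exists [ffun v => [pick x in pblock M v] == Some v]; rewrite inE.
apply/forall_inP => e eM; have /eqP/cards2P[a [b [ab eE]]] := M2 e eM.
have pb v : v \in e -> pblock M v = e by exact: def_pblock.
rewrite eE cut_by2 !ffunE !pb ?eE ?set21 ?set22 //.
case: pickP => [x|/(_ a)]; last by rewrite set21.
have ba : b != a by rewrite eq_sym.
by case/set2P=> ->; rewrite !(inj_eq Some_inj) !eqxx ?(negPf ab) ?(negPf ba).
Qed.

(** Vertices matched by [M] have opposite signs; any other two distinct vertices have uncorrelated
    signs. *)
Lemma sum_signs_le0 (R : realDomainType) (T : finType) (M : {set {set T}})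
    (z z' : T) :
    simple_graph M -> trivIset M -> z != z' ->
  \sum_(s in cuts M) ((-1) ^+ s z * (-1) ^+ s z' : R) <= 0.
Proof.
move=> M2 Mt zz'.
(* An uncovered vertex counts as a block by itself. *)
pose B := if z \in cover M then pblock M z else [set z].
have Bz : z \in B by rewrite /B; case: ifP; rewrite ?mem_pblock // inE.
have [Bz'|Bz'] := boolP (z' \in B).
  have [zM e] : z \in cover M /\ B = pblock M z.
    move: Bz'; rewrite /B; case: ifP => // _; rewrite inE => /eqP E.
    by rewrite E eqxx in zz'.
  have BM : B \in M by rewrite e pblock_mem.
  have eB : B = [set z; z'].
    apply/esym/eqP; rewrite eqEcard (M2 B BM) cards2 zz' leqnn andbT.
    by apply/subsetP => x /set2P[]->.
  apply: sumr_le0 => s; rewrite inE => /forall_inP/(_ _ BM).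
  rewrite eB cut_by2; case: (s z) (s z') => [] [] // _;
    by rewrite ?expr0 ?expr1 ?mul1r ?mulr1 lerN10.
(* Moving the whole block of z to the other side keeps every edge of M cut. *)
pose f (s : {ffun T -> bool}) := [ffun x => s x (+) (x \in B)].
have fK : involutive f.
  by move=> s; apply/ffunP => x; rewrite !ffunE -addbA addbb addbF.
have Bblock e x y : e \in M -> x \in e -> y \in e -> (x \in B) = (y \in B).
  move=> eM; have main a b : a \in e -> b \in e -> a \in B -> b \in B.
    rewrite /B; case: ifP => zM ae be.
      move=> ap; suff <- : e = pblock M z by [].
      exact: trivIset_mem Mt eM (pblock_mem zM) ae ap.
    rewrite inE => /eqP E; case/negP: (negbT zM); apply/bigcupP.
    by exists e => //; rewrite -E.
  by move=> xe ye; apply/idP/idP; apply: main.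
have fcut s : (f s \in cuts M) = (s \in cuts M).
  have main t : t \in cuts M -> f t \in cuts M.
    rewrite !inE => /forall_inP h; apply/forall_inP => e eM.
    have /exists_inP[x xe /exists_inP[y ye sxy]] := h e eM.
    apply/exists_inP; exists x => //; apply/exists_inP; exists y => //.
    rewrite !ffunE (Bblock e x y) //.
    by move: sxy; case: (t x) (t y) (y \in B) => [] [] [].
  by apply/idP/idP; [move/main; rewrite fK | exact: main].
set S := \sum_(s in _) _.
suff /eqP: S = - S by rewrite -addr_eq0 -mulr2n mulrn_eq0 /= => /eqP->.
rewrite {1}/S (reindex_inj (inv_inj fK)) /= -sumrN.
apply: eq_big => [s|s _]; first exact: fcut.
rewrite !ffunE Bz (negPf Bz') addbF.
by case: (s z); rewrite /= ?expr0 ?expr1 ?mul1r ?mulN1r ?opprK.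
Qed.

(** Expand the square: the diagonal gives the right-hand side, and the other terms are nonpositive
    because [a] is nonnegative. *)
Lemma second_moment (R : realDomainType) (T : finType) (M : {set {set T}})
    (a : T -> R) :
    simple_graph M -> trivIset M -> (forall z, 0 <= a z) ->
  \sum_(s in cuts M) (\sum_z a z * (-1) ^+ s z) ^+ 2
    <= #|cuts M|%:R * \sum_z a z ^+ 2.
Proof.
move=> M2 Mt a0.
have E (s : {ffun T -> bool}) : (\sum_z a z * (-1) ^+ s z) ^+ 2
    = \sum_z \sum_z' a z * a z' * ((-1) ^+ s z * (-1) ^+ s z').
  rewrite expr2 mulr_suml; apply: eq_bigr => z _; rewrite mulr_sumr.
  by apply: eq_bigr => z' _; rewrite mulrACA.
under eq_bigr => s _ do rewrite E.
rewrite exchange_big mulr_sumr; apply: ler_sum => z _ /=.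
rewrite exchange_big (bigD1 z) //= -[leRHS]addr0 lerD //.
  under eq_bigr => s _ do rewrite -signr_addb addbb mulr1.
  by rewrite sumr_const expr2 mulr_natl.
apply: sumr_le0 => z' zz'; rewrite -mulr_sumr mulr_ge0_le0 ?mulr_ge0 //.
by rewrite sum_signs_le0 // eq_sym.
Qed.

(** The bound [|x| <= (x ^+ 2 / l + l) / 2] plays the role of Cauchy-Schwarz without square
    roots. *)
Lemma mean_abs_deviation (R : realFieldType) (T : finType) (M : {set {set T}})
    (a : T -> R) (l : R) :
    simple_graph M -> trivIset M -> (forall z, 0 <= a z) -> 0 < l ->
    \sum_z a z ^+ 2 <= l ^+ 2 ->
  \sum_(s in cuts M) `|\sum_z a z * (-1) ^+ s z| <= #|cuts M|%:R * l.
Proof.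
move=> M2 Mt a0 l0 al.
have amgm (x : R) : `|x| <= (x ^+ 2 / l + l) / 2.
  rewrite -real_normK ?num_real // ler_pdivlMr // -(ler_pM2r l0) mulrDl.
  rewrite divfK ?gt_eqF // -subr_ge0.
  have -> : `|x| ^+ 2 + l * l - `|x| * 2 * l = (`|x| - l) ^+ 2 by ring.
  exact: sqr_ge0.
apply: le_trans (ler_sum _ (fun s _ => amgm _)) _.
rewrite -mulr_suml big_split /= -mulr_suml sumr_const ler_pdivrMr //.
rewrite -mulr_natl; set X := \sum_(s in _) _.
have : X / l <= #|cuts M|%:R * l.
  rewrite ler_pdivrMr // -mulrA -expr2; apply: le_trans (second_moment M2 Mt a0) _.
  by rewrite ler_wpM2l.
by lra.
Qed.

Lemma exists_le_mean (R : realDomainType) (I : finType) (A : {set I})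
    (F : I -> R) (k : R) :
    A != set0 -> \sum_(i in A) F i <= #|A|%:R * k ->
  exists2 i, i \in A & F i <= k.
Proof.
move=> A0 h; have [/exists_inP[i iA Fi]|no] := boolP [exists i in A, F i <= k].
  by exists i.
move: h; rewrite leNgt mulr_natl -sumr_const => /negP[].
have /set0Pn[j jA] := A0.
apply: ltr_sum; first by apply/hasP; exists j; rewrite ?mem_index_enum.
move=> i iA; rewrite ltNge; apply: contra no => Fi.
by apply/exists_inP; exists i.
Qed.

Lemma card_cover_simple (T : finType) (M : {set {set T}}) :
  simple_graph M -> trivIset M -> #|cover M| = (2 * #|M|)%N.
Proof.
move=> M2 Mt; rewrite -sum1_card big_trivIset // mulnC -sum_nat_const.
by apply: eq_bigr => e eM; rewrite sum1_card M2.
Qed.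

(** One cut must control both sums, so their combination is averaged. Each of the [2 * #|M|] covered
    vertices contributes at most [4 * l + 2 * (2 * l)] on average. The coefficients 4 and 2 are
    twice those of the errors in [dual_inequality]. *)
Lemma exists_balanced_cut (R : realFieldType) (T : finType)
    (M : {set {set T}}) (a k : T -> T -> R) (l : R) :
    simple_graph M -> trivIset M -> 0 < l ->
    (forall u z, 0 <= a u z) -> (forall u, \sum_z a u z ^+ 2 <= l ^+ 2) ->
    (forall u z, 0 <= k u z) -> (forall u, \sum_z k u z <= 2) ->
  exists2 s, s \in cuts M &
    let dev u := `|\sum_z a u z * (-1) ^+ s z| in
    4 * \sum_(u in cover M) dev u
      + 2 * \sum_(u in cover M) \sum_z k u z * dev z <= 16 * l * #|M|%:R.
Proof.
move=> M2 Mt l0 a0 al k0 k2.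
apply: exists_le_mean; first exact: cuts_neq0.
rewrite big_split /= -!mulr_sumr.
have meandev u := mean_abs_deviation M2 Mt (a0 u) l0 (al u).
set n : R := #|cuts M|%:R.
have n0 : 0 <= n * l by rewrite mulr_ge0 // ltW.
have cardV : #|cover M|%:R = 2 * #|M|%:R :> R.
  by rewrite card_cover_simple // natrM.
have b1 : \sum_(s in cuts M) \sum_(u in cover M) `|\sum_z a u z * (-1) ^+ s z|
    <= 2 * #|M|%:R * (n * l).
  rewrite exchange_big -cardV mulr_natl -sumr_const /=.
  by apply: ler_sum => u _; exact: meandev.
have b2 : \sum_(s in cuts M) \sum_(u in cover M) \sum_z
      k u z * `|\sum_z' a z z' * (-1) ^+ s z'| <= 2 * #|M|%:R * (2 * (n * l)).
  rewrite exchange_big -cardV mulr_natl -sumr_const /=.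
  apply: ler_sum => u _; rewrite exchange_big /=.
  apply: (@le_trans _ _ (\sum_z k u z * (n * l))).
    by apply: ler_sum => z _; rewrite -mulr_sumr ler_wpM2l.
  by rewrite -mulr_suml ler_wpM2r.
by lra.
Qed.

(** * The matching bound *)

(** Meant for [c] equal to [2 / beta] on cut edges of H, with [eta] the deviation of twice the cut
    degree from [D]. The edge inequalities [g u + D z <= q u z] are summed with multipliers [m]; the
    row sums [P] and column sums [Q] of [c u z * q u z] have the same total. *)
Lemma dual_inequality (R : realType) (T : finType) (A : {set T})
    (W tau : R) (c om : T -> T -> R) (D y eta : T -> R) :
    1 <= W -> tau = 1 - 1 / (2 * W) ->
    (forall u z, 0 <= c u z) -> (forall u z, c u z = c z u) ->
    (forall u z, om u z = om z u) ->
    (forall z, 0 <= D z <= W) -> (forall z, 0 <= y z <= W) ->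
    (forall u, u \in A -> y u < D u) ->
    (forall u z, 0 < c u z -> D u + D z <= om u z) ->
    (forall u z, 0 < c u z -> om u z <= y u + y z) ->
    (forall u, \sum_z c u z * om u z = D u + eta u) ->
  (\sum_(u in A) (D u - y u) ^+ 2) / W
    + (2 * tau - 1) * \sum_(u in A) (D u - y u)
  <= tau ^+ 2 * \sum_z y z + 2 * \sum_(u in A) `|eta u|
     + \sum_(u in A) \sum_z c u z * `|eta z|.
Proof.
move=> W1 tauE c0 cC omC D0 y0 gA edge cover sumc.
have W0 : 0 < W by lra.
have [tau0 tau1] : 0 <= 2 * tau - 1 /\ 2 * tau - 1 <= 1.
  have : 0 <= 1 / W by rewrite divr_ge0 // ltW.
  have : 1 / W <= 1 by rewrite ler_pdivrMr // mul1r.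
  have -> : 2 * tau - 1 = 1 - 1 / W by rewrite tauE; field; rewrite gt_eqF.
  by move=> *; split; lra.
pose g u := D u - y u.
pose q u z := om u z - y u.
(* If [y z = 0] the quotient is 0, and for [u] in [A] so is [c u z]. *)
pose m u z := c u z * q u z / y z.
pose P u := \sum_z c u z * q u z.
pose Q z := \sum_(u in A) c u z * q u z.
have cpos u z : c u z = 0 \/ 0 < c u z.
  by have := c0 u z; rewrite le_eqVlt => /orP[/eqP<-|]; [left|right].
have D0' z : 0 <= D z by have /andP[] := D0 z.
have DW z : D z <= W by have /andP[] := D0 z.
have y0' z : 0 <= y z by have /andP[] := y0 z.
have yW z : y z <= W by have /andP[] := y0 z.
have g0 u : u \in A -> 0 < g u by move=> /gA; rewrite /g subr_gt0.
have facts u z : u \in A -> 0 < c u z ->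
    [/\ g u + D z <= q u z, 0 < q u z, q u z <= y z & 0 < y z].
  move=> uA cp; have := edge _ _ cp; have := cover _ _ cp; have := g0 u uA.
  by rewrite /g /q; have := D0' z => *; split; lra.
have m1 u z : u \in A -> m u z * (g u + D z) <= c u z * q u z.
  move=> uA; rewrite /m; case: (cpos u z) => [->|cp]; first by rewrite !mul0r.
  have [h1 h2 h3 h4] := facts u z uA cp.
  rewrite -mulrA ger_pMr ?mulr_gt0 // mulrC ler_pdivrMr // mul1r.
  exact: le_trans h3.
have m2 u z : u \in A -> c u z * q u z / W <= m u z.
  move=> uA; rewrite /m; case: (cpos u z) => [->|cp]; first by rewrite !mul0r.
  have [h1 h2 h3 h4] := facts u z uA cp.
  by rewrite ler_pM2l ?mulr_gt0 // lef_pV2.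
have m3 u z : u \in A -> m u z <= c u z.
  move=> uA; rewrite /m; case: (cpos u z) => [->|cp]; first by rewrite !mul0r.
  have [h1 h2 h3 h4] := facts u z uA cp.
  by rewrite -mulrA ger_pMr // ler_pdivrMr // mul1r.
have m0 u z : u \in A -> 0 <= m u z.
  move=> uA; rewrite /m; case: (cpos u z) => [->|cp]; first by rewrite !mul0r.
  have [h1 h2 h3 h4] := facts u z uA cp.
  by rewrite divr_ge0 ?mulr_ge0 // ltW.
(* As [om u z >= D u] on edges, [om u z - y u] is at least [om u z * (g u / D u)], whose weighted
   sum is known from [sumc]. *)
have Pge u : u \in A -> g u - `|eta u| <= P u.
  move=> uA; have Du : 0 < D u by have := g0 u uA; have := y0' u; rewrite /g; lra.
  have r01 : 0 <= g u / D u <= 1.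
    rewrite divr_ge0 ?(ltW (g0 u uA)) //= ler_pdivrMr // mul1r /g.
    by have := y0' u; lra.
  have : (D u + eta u) * (g u / D u) <= P u.
    rewrite -sumc mulr_suml; apply: ler_sum => z _.
    rewrite -mulrA; case: (cpos u z) => [->|cp]; first by rewrite !mul0r.
    rewrite ler_pM2l // /q /g.
    have h : D u <= om u z by have := edge _ _ cp; have := D0' z; lra.
    rewrite mulrBl divff ?gt_eqF // mulrBr mulr1 lerD2l lerN2.
    by rewrite mulrA ler_pdivlMr // mulrC ler_wpM2r.
  have -> : (D u + eta u) * (g u / D u) = g u + eta u * (g u / D u).
    by field; rewrite gt_eqF.
  have : - `|eta u| <= eta u * (g u / D u).
    have : `|eta u * (g u / D u)| <= `|eta u|.
      rewrite normrM (ger0_norm (x := g u / D u)); last by case/andP: r01.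
      by rewrite ler_piMr //; case/andP: r01.
    by rewrite ler_norml => /andP[].
  lra.
have Q0 z : 0 <= Q z.
  apply: sumr_ge0 => u uA; case: (cpos u z) => [->|cp]; first by rewrite mul0r.
  by have [_ h _ _] := facts u z uA cp; rewrite mulr_ge0 // ltW.
have QD z : Q z <= D z + `|eta z|.
  apply: (@le_trans _ _ (D z + eta z)); last by rewrite lerD2l ler_norm.
  rewrite -sumc; apply: (@le_trans _ _ (\sum_(u in A) c z u * om z u)).
    apply: ler_sum => u uA; rewrite cC omC ler_wpM2l // /q.
    by have := y0' u; lra.
  rewrite [leRHS](bigID [in A]) /= lerDl; apply: sumr_ge0 => u _.
  case: (cpos z u) => [->|cp]; first by rewrite mul0r.
  rewrite mulr_ge0 //; apply: le_trans (edge _ _ cp).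
  exact: addr_ge0.
have Qm z : \sum_(u in A) m u z = Q z / y z by rewrite /Q mulr_suml.
have PQ : \sum_z Q z = \sum_(u in A) P u by rewrite exchange_big.
(* The part with [g] uses [m >= c * q / W], [Pge] and [g <= W]; the part with [D] uses [QD] and
   [m <= c]. *)
have main : (\sum_(u in A) g u ^+ 2) / W - \sum_(u in A) `|eta u|
    + \sum_z Q z ^+ 2 / y z - \sum_(u in A) \sum_z c u z * `|eta z|
    <= \sum_z Q z.
  have tot : \sum_(u in A) \sum_z m u z * (g u + D z) <= \sum_z Q z.
    rewrite PQ; apply: ler_sum => u uA; apply: ler_sum => z _; exact: m1.
  apply: le_trans tot.
  under [leRHS]eq_bigr => u _ do
    (under eq_bigr => z _ do rewrite mulrDr; rewrite big_split /=).
  rewrite big_split /= -!addrA addrA lerD //.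
    rewrite mulr_suml -sumrB; apply: ler_sum => u uA.
    rewrite -mulr_suml; apply: (@le_trans _ _ (P u / W * g u)); last first.
      rewrite ler_wpM2r ?(ltW (g0 u uA)) // mulr_suml.
      by apply: ler_sum => z _; exact: m2.
    have gW : g u <= W by rewrite /g; have := DW u; have := y0' u; lra.
    rewrite -(ler_pM2r W0) mulrBl divfK ?gt_eqF //.
    have -> : P u / W * g u * W = P u * g u by field; rewrite gt_eqF.
    have := Pge u uA; have := g0 u uA; have := normr_ge0 (eta u).
    by move: gW; clear; nra.
  rewrite -lerBrDr opprK [X in X + _]exchange_big [X in _ + X]exchange_big /=.
  rewrite -big_split /=; apply: ler_sum => z _.
  rewrite -mulr_suml Qm.
  apply: (@le_trans _ _ (Q z / y z * (D z + `|eta z|))).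
    by rewrite expr2 mulrAC ler_wpM2l // divr_ge0.
  rewrite mulrDr lerD2l -Qm mulr_suml; apply: ler_sum => u uA.
  by rewrite ler_wpM2r // m3.
(* AM-GM: [2 tau Q y <= Q^2 + (tau y)^2] *)
have sq : 2 * tau * \sum_z Q z - tau ^+ 2 * \sum_z y z <= \sum_z Q z ^+ 2 / y z.
  rewrite !mulr_sumr -sumrB; apply: ler_sum => z _.
  have [yz|yz] := eqVneq (y z) 0.
    have -> : Q z = 0.
      apply: big1 => u uA; case: (cpos u z) => [->|cp]; first by rewrite mul0r.
      by have [_ _ _] := facts u z uA cp; rewrite yz ltxx.
    by rewrite yz expr0n /= !mulr0 mul0r subr0.
  have yp : 0 < y z by rewrite lt_neqAle eq_sym yz y0'.
  rewrite ler_pdivlMr // -subr_ge0.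
  have -> : Q z ^+ 2 - (2 * tau * Q z - tau ^+ 2 * y z) * y z
    = (Q z - tau * y z) ^+ 2 by ring.
  exact: sqr_ge0.
have Plow : \sum_(u in A) g u - \sum_(u in A) `|eta u| <= \sum_z Q z.
  by rewrite PQ -sumrB; apply: ler_sum => u uA; exact: Pge.
have E0 : 0 <= \sum_(u in A) `|eta u| by exact: sumr_ge0.
have h1 := ler_wpM2l tau0 Plow.
have h2 := ler_piMl E0 tau1.
rewrite -[\sum_(u in A) (D u - y u) ^+ 2]/(\sum_(u in A) g u ^+ 2).
rewrite -[\sum_(u in A) (D u - y u)]/(\sum_(u in A) g u).
move: main sq h1 h2; clear; lra.
Qed.

(** Since [S2 >= S - De / 2], the left side of the main inequality is at least [S - De / (2 * W)],
    hence at least [tau * De - lambda * X]. Against [tau ^+ 2 * Y] one factor [tau] cancels, so [De]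
    is at most [tau * Y] up to error. *)
Lemma ratio_bound (R : realFieldType) (eps lambda W tau : R)
    (X Y De S S2 nA E1 E2 : R) :
    0 < eps -> eps < 1 / 2 -> 1 <= W -> lambda = eps / (100 * W) ->
    tau = 1 - 1 / (2 * W) -> 0 <= X -> 0 <= Y ->
    S2 / W + (2 * tau - 1) * S <= tau ^+ 2 * Y + 2 * E1 + E2 ->
    S - nA / 4 <= S2 -> nA <= 2 * De -> De - lambda * X <= S ->
    X <= Y + De -> 4 * E1 + 2 * E2 <= 16 * lambda * X ->
  X <= (2 - 1 / (2 * W) + eps) * Y.
Proof.
move=> e0 e1 W1 lE tE X0 Y0 main h1 h2 h3 h4 h5.
have W0 : 0 < W by lra.
pose i := W^-1.
have i0 : 0 < i by rewrite invr_gt0.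
have i1 : i <= 1 by rewrite invf_le1.
have {}tE : tau = 1 - i / 2 by rewrite tE /i; field; rewrite gt_eqF.
have -> : 2 - 1 / (2 * W) = 1 + tau by rewrite tE /i; field; rewrite gt_eqF.
have {}lE : lambda = eps * i / 100 by rewrite lE /i; field; rewrite gt_eqF.
have l1 : lambda <= eps / 100.
  by rewrite lE ler_pM2r ?invr_gt0 // ler_piMr // ltW.
have lX : lambda * X <= eps / 100 * X by rewrite ler_wpM2r.
have a1 : (S - De / 2) * i <= S2 * i by rewrite ler_pM2r //; lra.
(* Of the nine error units, eight come from [E1] and [E2] and one from [lambda * X]. *)
have a2 : tau * De <= tau * (tau * Y) + 9 * (eps / 100 * X).
  by move: main; rewrite -/i tE; nra.
have t2 : 1 / 2 <= tau by lra.
have a3 : De <= tau * Y + 18 * (eps / 100 * X).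
  rewrite -(ler_pM2l (_ : 0 < tau)); last by lra.
  rewrite mulrDr; apply: le_trans a2 _; rewrite lerD2l.
  have : 0 <= eps / 100 * X by rewrite mulr_ge0 // divr_ge0 // ltW.
  by nra.
have a4 : X * (1 - 18 * (eps / 100)) <= (1 + tau) * Y by lra.
have p : 0 < 1 - 18 * (eps / 100) by lra.
rewrite -(ler_pM2r p); apply: le_trans a4 _.
(* It remains that [18 * (eps / 100)] times [1 + tau + eps], a factor below 5/2, is at most
   [eps]. *)
rewrite mulrAC ler_wpM2r //.
have t1 : tau <= 1 by lra.
by nra.
Qed.

(** For [b >= 3], [ln b >= 1 - b^-1 >= 1 / 2]. This turns the assumption on beta into the second
    moment bound [W ^+ 2 / beta <= lambda ^+ 2]. *)
Lemma beta_lower_bound (R : realType) (b k : R) :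
  3 <= b -> 0 <= k -> 2 * k <= b / ln b -> k <= b.
Proof.
move=> b3 k0.
have b0 : 0 < b by lra.
have lnb : 1 / 2 <= ln b.
  have : ln b^-1 <= b^-1 - 1.
    have -> : b^-1 = 1 + (b^-1 - 1) by lra.
    apply: le_trans (le_ln1Dx _) _; last by lra.
    by have : 0 < b^-1 by [rewrite invr_gt0]; lra.
  have : b^-1 <= 3^-1 by rewrite lef_pV2 // posrE; lra.
  by rewrite lnV ?posrE //; lra.
have l0 : 0 < ln b by lra.
by rewrite ler_pdivlMr //; nra.
Qed.

Theorem theorem14 (R : realType) (eps lambda : R) (W : nat) (beta betam : int)
    (T : finType) (G H : {set {set T}}) (w : {set T} -> nat)
    (eps_gt0 : 0 < eps) (eps_lt : eps < 1 / 2)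
    (W_ge1 : (1 <= W)%N)
    (lambdaE : lambda = eps / (100 * W%:R))
    (beta_ge3 : 3 <= beta) (betam_le : betam + 2 <= beta)
    (beta_large : 2 * W%:R ^+ 2 * lambda ^- 2 <= beta%:~R / ln (beta%:~R : R))
    (betam_large : (1 - lambda) * beta%:~R <= betam%:~R)
    (G_simple : simple_graph G)
    (w_range : forall e, e \in G -> (1 <= w e <= W)%N)
    (H_EDCS : wEDCS w beta betam G H)
    (MG : {set {set T}}) (MG_max : max_weight_matching w G MG) :
  exists MH : {set {set T}}, matching H MH /\
    (weight w MG)%:R <= (2 - 1 / (2 * W%:R) + eps) * (weight w MH)%:R.
Proof.
have [HG HE HnE] := H_EDCS; have [[MGG MGt] _] := MG_max.
have MG2 : simple_graph MG by move=> e /(subsetP MGG); exact: G_simple.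
set Wr : R := W%:R in lambdaE beta_large *.
pose b : R := beta%:~R.
have b3 : 3 <= b by rewrite -[3]/(3%:~R) ler_int.
have b0 : 0 < b by lra.
have W1 : 1 <= Wr by rewrite ler1n.
have W0 : 0 < Wr by lra.
have l0 : 0 < lambda by rewrite lambdaE divr_gt0 // mulr_gt0.
have lb : Wr ^+ 2 / b <= lambda ^+ 2.
  rewrite ler_pdivrMr // mulrC -ler_pdivrMr ?exprn_gt0 //.
  apply: beta_lower_bound => //; first by rewrite divr_ge0 ?exprn_ge0 // ltW.
  by rewrite mulrA.

(* Normalised degrees in the EDCS *)
pose h u z : bool := [set u; z] \in H.
pose om u z : R := (w [set u; z])%:R.
pose a u z : R := (h u z)%:R * om u z / b.
pose D u : R := \sum_z a u z.
have hC u z : h u z = h z u by rewrite /h setUC.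
have omC u z : om u z = om z u by rewrite /om setUC.
have om0 u z : 0 <= om u z by exact: ler0n.
have omr u z : h u z -> 1 <= om u z <= Wr.
  by move=> /(subsetP HG)/w_range; rewrite /om /Wr ler1n ler_nat.
have a0 u z : 0 <= a u z by rewrite /a divr_ge0 ?mulr_ge0 // ltW.
have wdegD u : (wdeg w H u)%:R = D u * b.
  rewrite /wdeg natr_sum big_mkcond /D mulr_suml; apply: eq_bigr => z _.
  rewrite /a divfK ?gt_eqF // inE setUC -/(h u z) -/(om u z).
  by case: (h u z); rewrite ?mul1r ?mul0r.
have edgeD u z : h u z -> D u + D z <= om u z.
  move=> /HE; rewrite -(ler_int R) intrD intrM -!pmulrn !wdegD -mulrDl.
  by rewrite -/b mulrC ler_pM2l.
have nedgeD u z : [set u; z] \in G :\: H -> (1 - lambda) * om u z <= D u + D z.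
  move=> /HnE; rewrite -(ler_int R) intrD intrM -!pmulrn !wdegD -mulrDl => hb.
  rewrite -(ler_pM2r b0); apply: le_trans hb.
  by rewrite mulrAC ler_wpM2r.
have D0 u : 0 <= D u by apply: sumr_ge0.
have Dle u z : h u z -> D u <= om u z.
  by move=> /edgeD; have := D0 z; lra.
have DW u : D u <= Wr.
  have [/existsP[z uz]|no] := boolP [exists z, h u z].
    by apply: le_trans (Dle _ _ uz) _; case/andP: (omr _ _ uz).
  rewrite /D big1 ?(ltW W0) // => z _; rewrite /a.
  have /negPf-> : ~~ h u z by apply: contra no => uz; apply/existsP; exists z.
  by rewrite !mul0r.
(* Each edge at [u] weighs at least [D u], and together they weigh [b * D u]. *)
have degH u : \sum_z (h u z)%:R <= b.
  have [/existsP[z uz]|no] := boolP [exists z, h u z]; last first.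
    rewrite big1 ?(ltW b0) // => z _.
    by have /negPf-> : ~~ h u z by apply: contra no => uz; apply/existsP; exists z.
  have Du : 0 < D u.
    rewrite /D (bigD1 z) //= ltr_wpDr ?sumr_ge0 //.
    by rewrite /a uz mul1r divr_gt0 //; case/andP: (omr _ _ uz) => ? _; lra.
  rewrite -(ler_pM2r Du) -[b * _]mulrC mulr_suml /D mulr_suml.
  apply: ler_sum => t _; rewrite /a divfK ?gt_eqF //.
  by case E: (h u t); rewrite ?mul0r // !mul1r Dle.
have a2 u : \sum_z a u z ^+ 2 <= lambda ^+ 2.
  apply: le_trans lb; apply: (@le_trans _ _ (D u * (Wr / b))).
    rewrite /D mulr_suml; apply: ler_sum => z _; rewrite expr2 ler_wpM2l //.
    rewrite /a ler_pM2r ?invr_gt0 //; case E: (h u z); rewrite ?mul0r ?mul1r.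
      by case/andP: (omr _ _ E).
    exact: ltW.
  by rewrite expr2 -mulrA ler_wpM2r // divr_ge0 // ltW.
pose k u z : R := 2 / b * (h u z)%:R.
have k0 u z : 0 <= k u z by rewrite /k mulr_ge0 // divr_ge0 // ltW.
have k2 u : \sum_z k u z <= 2.
  by rewrite -mulr_sumr mulrAC ler_pdivrMr // ler_wpM2l.
have [s sc] := exists_balanced_cut MG2 MGt l0 a0 a2 k0 k2.
(* Twice the indicator that [s] cuts an edge is 1 minus the product of the signs of its ends; summed
   against [a u], this gives [D u + eta u]. *)
pose eta u := - (-1) ^+ s u * \sum_z a u z * (-1) ^+ s z.
have etaE u : `|\sum_z a u z * (-1) ^+ s z| = `|eta u|.
  by rewrite /eta normrM normrN normrX normrN1 expr1n mul1r.
rewrite /=; under eq_bigr => u _ do rewrite etaE.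
under [X in 2 * X]eq_bigr => u _ do (under eq_bigr => z _ do rewrite etaE).
move=> balanced.

(* Vertex cover of the cut graph *)
pose HC := [set e in H | cut_by s e].
have HCH : HC \subset H by apply/subsetP => e; rewrite inE => /andP[].
have cutE e : e \in G -> cut_by s e ->
    exists x y, [/\ s x, ~~ s y & e = [set x; y]].
  move=> /G_simple/eqP/cards2P[x [y [_ ->]]]; rewrite cut_by2 => sxy.
  case E: (s x) sxy => /= sy; first by exists x, y.
  by exists y, x; rewrite setUC E; split => //; case: (s y) sy.
have [|M [y1 [[MHC Mt] cov1 wM]]] := @egervary T s HC w.
  by move=> e; rewrite inE => /andP[/(subsetP HG)]; exact: cutE.
exists M; split; first by split => //; exact: subset_trans HCH.
(* Capping at [W] keeps a cover, since weights are at most [W], and does not increase the total. *)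
pose yn v := minn (y1 v) W.
pose y v : R := (yn v)%:R.
have sum2 (F : T -> nat) x z : s x != s z ->
    (\sum_(v in [set x; z]) F v = F x + F z)%N.
  by move=> sxz; rewrite big_setU1 ?big_set1 // inE; apply: contra sxz => /eqP->.
have covn x z : h x z -> s x != s z -> (w [set x; z] <= yn x + yn z)%N.
  move=> hxz sxz; have /cov1 : [set x; z] \in HC by rewrite inE cut_by2 sxz andbT.
  have /andP[_] := w_range _ (subsetP HG _ hxz); rewrite sum2 // /yn.
  rewrite /minn; case: ifP => _; case: ifP => _ hW hc //;
    first [exact: hc | exact: leq_trans hW (leq_addl _ _)
          | exact: leq_trans hW (leq_addr _ _)].
have covy x z : h x z -> s x != s z -> om x z <= y x + y z.
  by move=> hxz sxz; rewrite -natrD ler_nat; exact: covn.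
have y0 z : 0 <= y z <= Wr by rewrite ler0n ler_nat geq_minr.

(* Uncovered edges of the maximum matching *)
pose Bad := [set e in MG | (\sum_(v in e) yn v < w e)%N].
have BadMG : Bad \subset MG by apply/subsetP => e; rewrite inE => /andP[].
have Bad2 : simple_graph Bad by move=> e /(subsetP BadMG); exact: MG2.
have Badt : trivIset Bad.
  apply/trivIsetP => e f /(subsetP BadMG) eM /(subsetP BadMG) fM.
  exact: (trivIsetP MGt).
have coverB : cover Bad \subset cover MG.
  apply/subsetP => v /bigcupP[e eB ve]; apply/bigcupP; exists e => //.
  exact: subsetP BadMG _ eB.
pose A := [set v in cover Bad | y v < D v].
have AV : {subset A <= cover MG}.
  by move=> v; rewrite inE => /andP[/(subsetP coverB)].
pose c u z : R := 2 / b * (h u z && (s u != s z))%:R.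
have b2 : 0 <= 2 / b by rewrite divr_ge0 // ltW.
have c0 u z : 0 <= c u z by rewrite mulr_ge0.
have ck u z : c u z <= k u z.
  by rewrite /c /k ler_wpM2l // ler_nat; case: (h u z); case: (s u != s z).
have cpos u z : 0 < c u z -> h u z /\ s u != s z.
  by rewrite /c; case: andP => [[]//|_]; rewrite mulr0 ltxx.
pose tau : R := 1 - 1 / (2 * Wr).
have key : (\sum_(u in A) (D u - y u) ^+ 2) / Wr
      + (2 * tau - 1) * \sum_(u in A) (D u - y u)
    <= tau ^+ 2 * \sum_z y z + 2 * \sum_(u in A) `|eta u|
       + \sum_(u in A) \sum_z c u z * `|eta z|.
  apply: (dual_inequality (om := om)) => //.
  - by move=> u z; rewrite /c hC eq_sym.
  - by move=> z; rewrite D0 DW.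
  - by move=> u; rewrite inE => /andP[].
  - by move=> u z /cpos[hz _]; exact: edgeD.
  - by move=> u z /cpos[hz sz]; exact: covy.
  - move=> u; rewrite /D /eta mulr_sumr -big_split; apply: eq_bigr => z _ /=.
    rewrite /c /a; case: (h u z); last by rewrite /= !(mulr0, mul0r) addr0.
    by case: (s u); case: (s z); rewrite /= ?expr0 ?expr1; field; rewrite gt_eqF.
(* the total deficit *)
pose De : R := \sum_(e in Bad) ((w e)%:R - \sum_(v in e) y v).
have sumy e : \sum_(v in e) y v = (\sum_(v in e) yn v)%:R by rewrite natr_sum.
have wMG : (weight w MG)%:R = \sum_(e in MG) (w e)%:R :> R by rewrite natr_sum.
have cardMG : #|MG|%:R <= (weight w MG)%:R :> R.
  rewrite ler_nat -sum1_card; apply: leq_sum => e eM.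
  by case/andP: (w_range _ (subsetP MGG _ eM)).
have YM : \sum_z y z <= (weight w M)%:R.
  rewrite -natr_sum ler_nat; apply: leq_trans wM.
  by apply: leq_sum => z _; exact: geq_minl.
have tau2 : 0 <= 2 - 1 / (2 * Wr) + eps.
  have : 1 / (2 * Wr) <= 1 by rewrite ler_pdivrMr; lra.
  by move: eps_gt0; clear; lra.
apply: le_trans (ler_wpM2l tau2 YM).
apply: (ratio_bound (lambda := lambda) (tau := tau) (De := De)
  (nA := #|A|%:R) eps_gt0 eps_lt W1 _ _ _ _ key) => //.
- by apply: sumr_ge0 => z _; exact: ler0n.
(* [x ^+ 2 >= x - 1 / 4], by completing the square. *)
- rewrite -sumr_const mulr_suml -sumrB; apply: ler_sum => u _.
  rewrite -subr_ge0.
  have -> : (D u - y u) ^+ 2 - (D u - y u - 1 / 4) = (D u - y u - 1 / 2) ^+ 2.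
    by field.
  exact: sqr_ge0.
(* Weights and [yn] are natural numbers, so each edge of [Bad], with its two ends, has deficit at
   least 1. *)
- apply: (@le_trans _ _ #|cover Bad|%:R).
    rewrite ler_nat subset_leq_card //.
    by apply/subsetP => v; rewrite inE => /andP[].
  rewrite card_cover_simple // natrM ler_wpM2l // -sumr_const.
  apply: ler_sum => e; rewrite inE => /andP[_ eB].
  by rewrite sumy -natrB ?ler1n ?subn_gt0 // ltnW.
(* Ends outside [A] have [D v - y v <= 0], so restricting to [A] only increases the sum. *)
- apply: (@le_trans _ _ (\sum_(v in cover Bad) (D v - y v))); last first.
    rewrite (bigID (fun v => y v < D v)) /= -[leRHS]addr0 lerD //.
      by rewrite le_eqVlt; apply/orP; left; apply/eqP; apply: eq_bigl => v;
         rewrite !inE.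
    by apply: sumr_le0 => v /andP[_]; rewrite -leNgt subr_le0.
  rewrite big_trivIset //; apply: (@le_trans _ _
      (\sum_(e in Bad) ((w e)%:R - \sum_(v in e) y v - lambda * (w e)%:R))).
    rewrite sumrB lerD2l lerN2 -mulr_sumr ler_wpM2l ?(ltW l0) // wMG.
    rewrite (big_setID Bad (A := MG)) /= (setIidPr BadMG) lerDl.
    by apply: sumr_ge0 => e _; exact: ler0n.
  apply: ler_sum => e; rewrite inE => /andP[eM eB].
  have eG := subsetP MGG _ eM.
  have es : cut_by s e by move: sc; rewrite inE => /forall_inP/(_ _ eM).
  have [x [z [sx sz eE]]] := cutE e eG es.
  have sxz : s x != s z by rewrite sx (negPf sz).
  (* Every edge of [MG] is cut, so if [e] were in [H], [yn] would cover it. *)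
  have eH : e \notin H.
    apply/negP => eH; move: eB; rewrite ltnNge eE sum2 // covn //.
    by rewrite /h -eE.
  have := @nedgeD x z; rewrite -eE inE eH eG => /(_ isT); rewrite /om -eE.
  rewrite sumrB sumy eE sum2 // natrD big_setU1 ?big_set1 /=; last first.
    by rewrite inE; apply: contra sxz => /eqP->.
  by rewrite -eE /y; lra.
- rewrite wMG.
  have -> : \sum_(e in MG) (w e)%:R = \sum_(v in cover MG) y v
      + \sum_(e in MG) ((w e)%:R - \sum_(v in e) y v).
    rewrite big_trivIset // -big_split.
    by apply: eq_bigr => e _ /=; rewrite addrC subrK.
  apply: lerD.
    rewrite [leRHS](bigID [in cover MG]) /= lerDl.
    by apply: sumr_ge0 => z _; exact: ler0n.
  (* Edges of [MG] outside [Bad] are covered and have nonpositive deficit. *)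
  rewrite (big_setID Bad) /= (setIidPr BadMG) -[leRHS]addr0 lerD //.
  apply: sumr_le0 => e; rewrite !inE => /andP[+ eM]; rewrite eM /= -leqNgt => eB.
  by rewrite subr_le0 sumy ler_nat.
(* The errors over [A] and [c] are dominated by those over [cover MG] and [k], and [#|MG|] is at
   most the weight of [MG]. *)
- apply: (@le_trans _ _ (16 * lambda * #|MG|%:R)); last first.
    by rewrite ler_wpM2l // mulr_ge0 // ltW.
  apply: le_trans balanced.
  have sub (F : T -> R) : (forall u, 0 <= F u) ->
      \sum_(u in A) F u <= \sum_(u in cover MG) F u.
    move=> F0; rewrite [leRHS](big_setID A) /=.
    have /setIidPr-> : A \subset cover MG by apply/subsetP.
    by rewrite lerDl sumr_ge0.
  rewrite lerD ?ler_wpM2l ?sub //.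
  apply: (@le_trans _ _ (\sum_(u in A) \sum_z k u z * `|eta z|)).
    by apply: ler_sum => u _; apply: ler_sum => z _; rewrite ler_wpM2r.
  by apply: sub => u; apply: sumr_ge0 => z _; rewrite mulr_ge0.
Qed.
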